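(* For every $\nu,\nu'\in\mathbb{R}$, we have the Mehler's formula $$\frac{1}{1-\nu\nu' uv}\,\exp\left(-\frac{\nu\nu'\left[(\nu|z|^2+\nu'|w|^2)\,uv - u z w - v\,\overline{z}\,\overline{w}\right]}{1-\nu\nu' uv}\right) = \sum_{m,n=0}^{\infty} \frac{u^m v^n}{m!\,n!}\, H_{m,n}^{\nu}(z,\overline{z})\, H_{m,n}^{\nu'}(w,\overline{w}),\qquad z,w\in\mathbb{C},$$ valid for every $u,v\in\mathbb{C}$ such that $uv\in\mathbb{R}$ and $\nu\nu' uv<1$.
   Context: For a real number $\nu$ and nonnegative integers $m,n$, the (weighted) univariate complex Hermite polynomials are $$H_{m,n}^{\nu}(z,\overline{z}) = (-1)^{m+n} e^{\nu z\overline{z}}\, \frac{\partial^{m+n}}{\partial \overline{z}^{m}\,\partial z^{n}}\left(e^{-\nu z\overline{z}}\right),\qquad z\in\mathbb{C},$$ where $\partial/\partial z=\frac12(\partial_x-i\partial_y)$ and $\partial/\partial\overline{z}=\frac12(\partial_x+i\partial_y)$ for $z=x+iy$ are the Wirtinger derivatives.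
   Formalization: The formula is proved under the added condition νν'uv > -1, i.e. -1 < νν'uv < 1; as printed it fails for νν'uv ≤ -1, since at z = w = 0 the right-hand side is the divergent series Σ(νν'uv)^m (e.g. ν = ν' = 1, u = 1, v = -2). *)

(* Defs.v *)
From Stdlib Require Import Reals.
From Coquelicot Require Import Coquelicot.

Open Scope C_scope.

Definition Cexp (z : C) : C :=
  RtoC (exp (Re z)) * (cos (Im z), sin (Im z)).

(* Real partial derivatives of a function of [z = x + iy], componentwise.
   [Derive] is total, and meaningful here because it is only applied to
   smooth functions. *)
Definition dx (f : C -> C) (z : C) : C :=
  (Derive (fun t : R => Re (f (t, Im z))) (Re z),
   Derive (fun t : R => Im (f (t, Im z))) (Re z)).

Definition dy (f : C -> C) (z : C) : C :=
  (Derive (fun t : R => Re (f (Re z, t))) (Im z),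
   Derive (fun t : R => Im (f (Re z, t))) (Im z)).

Definition wirtinger (f : C -> C) (z : C) : C :=
  / 2 * (dx f z - Ci * dy f z).

Definition wirtinger_bar (f : C -> C) (z : C) : C :=
  / 2 * (dx f z + Ci * dy f z).

Definition hermite (nu : R) (m n : nat) (z : C) : C :=
  (- (1)) ^ (m + n) * Cexp (nu * (z * Cconj z)) *
  Nat.iter m wirtinger_bar
    (Nat.iter n wirtinger (fun x : C => Cexp (- (nu * (x * Cconj x))))) z.

(* Absolute convergence is required, so that the sum depends neither on the
   order of the terms nor on the way in which the double series is iterated.
   [sum_n f N] has the [N + 1] terms [f 0, ..., f N]. *)
Definition is_double_series (a : nat -> nat -> C) (l : C) : Prop :=
  (exists B : R, forall M N : nat,
     (sum_n (fun m => sum_n (fun n => Cmod (a m n)) N) M <= B)%R) /\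
  filterlim
    (fun p : nat * nat => sum_n (fun m => sum_n (fun n => a m n) (snd p)) (fst p))
    (filter_prod eventually eventually) (locally l).

(* Main.v *)
Require Import Defs.
From Stdlib Require Import Reals Factorial Lra Lia.
From Coquelicot Require Import Coquelicot.

(* Up to the sign [(-1)^(m+n)], which cancels in the products, the Hermite
   polynomials are [herm c a b m n] with [c = - nu], [a = - nu z] and
   [b = - nu zbar]. In this generality the sum over [m], at fixed [n], is
     [Sum_m u^m / m! * herm c a b m n * herm c' a' b' m n
        = exp (u a a') * herm (c c' u) (b + c u a') (b' + c' u a) n n],
   and the remaining sum over [n] is the generating function of the Laguerre
   polynomials, obtained by summing a negative binomial series along diagonals.
   All terms are majorized by those with every parameter replaced by its modulus,
   for which the same identity holds: this gives absolute convergence, and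
   justifies every rearrangement. *)

Open Scope C_scope.

(** * Complex-valued derivatives and the exponential series *)

(** Componentwise, to match the real partial derivatives in [dx] and [dy]. *)
Definition is_Cderive (f : R -> C) (t : R) (l : C) : Prop :=
  is_derive (fun s => Re (f s)) t (Re l) /\ is_derive (fun s => Im (f s)) t (Im l).

Lemma is_Cderive_ext (f g : R -> C) (t : R) (l : C) :
  (forall s, f s = g s) -> is_Cderive f t l -> is_Cderive g t l.
Proof.
intros E [H1 H2]; split.
- apply is_derive_ext with (2 := H1); intros s; now rewrite E.
- apply is_derive_ext with (2 := H2); intros s; now rewrite E.
Qed.

Lemma is_Cderive_eq (f : R -> C) (t : R) (k l : C) :
  is_Cderive f t k -> k = l -> is_Cderive f t l.
Proof. now intros H <-. Qed.

Lemma is_Cderive_const (c : C) (t : R) : is_Cderive (fun _ => c) t 0.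
Proof. split; apply (is_derive_const (K := R_AbsRing) (V := R_NormedModule)). Qed.

Lemma is_Cderive_plus (f g : R -> C) (t : R) (l k : C) :
  is_Cderive f t l -> is_Cderive g t k -> is_Cderive (fun s => f s + g s) t (l + k).
Proof.
intros [H1 H2] [H3 H4]; split;
  now apply (is_derive_plus (K := R_AbsRing) (V := R_NormedModule)).
Qed.

Lemma is_Cderive_mult (f g : R -> C) (t : R) (l k : C) :
  is_Cderive f t l -> is_Cderive g t k ->
  is_Cderive (fun s => f s * g s) t (l * g t + f t * k).
Proof.
assert (M : forall (a b : R -> R) x y, is_derive a t x -> is_derive b t y ->
  is_derive (fun s => a s * b s)%R t (x * b t + a t * y)%R).
{ intros a b x y Ha Hb.
  apply (is_derive_mult (K := R_AbsRing) a b t x y Ha Hb), Rmult_comm. }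
intros [H1 H2] [H3 H4]; split; simpl.
- evar_last.
  + apply (is_derive_minus (K := R_AbsRing) (V := R_NormedModule));
      [exact (M _ _ _ _ H1 H3) | exact (M _ _ _ _ H2 H4)].
  + unfold minus, plus, opp, Re, Im; simpl; ring.
- evar_last.
  + apply (is_derive_plus (K := R_AbsRing) (V := R_NormedModule));
      [exact (M _ _ _ _ H1 H4) | exact (M _ _ _ _ H2 H3)].
  + unfold plus, Re, Im; simpl; ring.
Qed.

Lemma is_Cderive_Cexp (f : R -> C) (t : R) (l : C) :
  is_Cderive f t l -> is_Cderive (fun s => Cexp (f s)) t (l * Cexp (f t)).
Proof.
assert (M : forall (a b : R -> R) x y, is_derive a t x -> is_derive b t y ->
  is_derive (fun s => exp (a s) * cos (b s))%R t
    (x * (exp (a t) * cos (b t)) - y * (exp (a t) * sin (b t)))%R /\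
  is_derive (fun s => exp (a s) * sin (b s))%R t
    (x * (exp (a t) * sin (b t)) + y * (exp (a t) * cos (b t)))%R).
{ intros a b x y Ha Hb.
  assert (ex_derive a t) by now exists x.
  assert (ex_derive b t) by now exists y.
  split; (auto_derive; [tauto|]);
    replace (Derive (fun s => a s) t) with x by (symmetry; now apply is_derive_unique);
    replace (Derive (fun s => b s) t) with y by (symmetry; now apply is_derive_unique);
    ring. }
intros [H1 H2]; destruct (M _ _ _ _ H1 H2) as [M1 M2].
assert (E : forall z, Cexp z = (exp (Re z) * cos (Im z), exp (Re z) * sin (Im z))%R).
{ intros z; unfold Cexp; apply injective_projections; simpl; ring. }
apply is_Cderive_ext
  with (fun s => (exp (Re (f s)) * cos (Im (f s)), exp (Re (f s)) * sin (Im (f s)))%R);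
  [intros s; now rewrite E|].
rewrite E; split.
- exact M1.
- exact M2.
Qed.

Lemma is_Cderive_RtoC (t : R) : is_Cderive RtoC t 1.
Proof.
split; simpl.
- apply (is_derive_id (K := R_AbsRing)).
- apply (is_derive_const (K := R_AbsRing) (V := R_NormedModule)).
Qed.

Lemma Cexp_plus (z w : C) : Cexp (z + w) = Cexp z * Cexp w.
Proof.
unfold Cexp; rewrite re_plus, im_plus, exp_plus, cos_plus, sin_plus.
apply injective_projections; simpl; ring.
Qed.

Lemma Cexp_0 : Cexp 0 = 1.
Proof.
unfold Cexp; simpl; rewrite exp_0, cos_0, sin_0.
apply injective_projections; simpl; ring.
Qed.

Lemma Cmod_Cexp (z : C) : Cmod (Cexp z) = exp (Re z).
Proof.
unfold Cexp; rewrite Cmod_mult, Cmod_R, Rabs_pos_eq by apply Rlt_le, exp_pos.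
unfold Cmod; simpl.
replace (cos (Im z) * (cos (Im z) * 1) + sin (Im z) * (sin (Im z) * 1))%R with 1%R.
- rewrite sqrt_1; ring.
- generalize (sin2_cos2 (Im z)); unfold Rsqr; lra.
Qed.

Lemma INR_fact_neq_0_C (n : nat) : RtoC (INR (fact n)) <> 0.
Proof. intros E; apply RtoC_inj in E; now apply INR_fact_neq_0 in E. Qed.

Lemma RtoC_fact_S (n : nat) :
  RtoC (INR (fact (S n))) = RtoC (INR (S n)) * RtoC (INR (fact n)).
Proof. now rewrite fact_simpl, mult_INR, RtoC_mult. Qed.

Lemma INR_S_neq_0_C (n : nat) : RtoC (INR (S n)) <> 0.
Proof. intros E; apply RtoC_inj in E; now apply not_0_INR in E. Qed.

Lemma RtoC_INR_S (n : nat) : RtoC (INR (S n)) = RtoC (INR n) + 1.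
Proof. now rewrite S_INR, RtoC_plus. Qed.

Lemma is_Cderive_pow (f : R -> C) (t : R) (l : C) (n : nat) :
  is_Cderive f t l ->
  is_Cderive (fun s => f s ^ S n) t (RtoC (INR (S n)) * f t ^ n * l).
Proof.
intros H; induction n as [|n IH].
- apply is_Cderive_ext with f; [intros s; simpl; ring|].
  replace (RtoC (INR 1) * f t ^ 0 * l) with l by (simpl; ring); exact H.
- apply is_Cderive_ext with (fun s => f s * f s ^ S n); [easy|].
  replace (RtoC (INR (S (S n))) * f t ^ S n * l)
    with (l * f t ^ S n + f t * (RtoC (INR (S n)) * f t ^ n * l))
    by (rewrite (RtoC_INR_S (S n)); simpl; ring).
  now apply is_Cderive_mult.
Qed.

(** The mean value theorem fails for complex values, so it is applied to the real and imaginary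
    parts separately; this costs the factor 2. *)
Lemma Cmod_increment_le (f df : R -> C) (K : R) :
  (forall t, is_Cderive f t (df t)) ->
  (forall t, (0 <= t <= 1)%R -> (Cmod (df t) <= K)%R) ->
  (Cmod (f 1%R - f 0%R) <= 2 * K)%R.
Proof.
intros D B.
assert (A : forall g dg : R -> R, (forall t, is_derive g t (dg t)) ->
  (forall t, (Rabs (dg t) <= Cmod (df t))%R) -> (Rabs (g 1 - g 0) <= K)%R).
{ intros g dg H1 H2.
  destruct (MVT_gen g 0 1 dg) as [c [Hc E]].
  - intros x _; apply H1.
  - intros x _; apply continuity_pt_filterlim.
    apply (ex_derive_continuous (K := R_AbsRing) (V := R_NormedModule)).
    eexists; apply H1.
  - rewrite E, Rminus_0_r, Rmult_1_r.
    rewrite Rmin_left, Rmax_right in Hc by lra.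
    eapply Rle_trans; [apply H2 | now apply B]. }
assert (H1 : (Rabs (Re (f 1%R - f 0%R)) <= K)%R).
{ apply (A (fun t => Re (f t)) (fun t => Re (df t))).
  - intros t; apply D.
  - intros t; apply re_le_Cmod. }
assert (H2 : (Rabs (Im (f 1%R - f 0%R)) <= K)%R).
{ apply (A (fun t => Im (f t)) (fun t => Im (df t))).
  - intros t; apply D.
  - intros t; eapply Rle_trans; [apply Rmax_r | apply Rmax_Cmod]. }
set (d := f 1%R - f 0%R) in *.
replace d with (RtoC (Re d) + Ci * RtoC (Im d))
  by (apply injective_projections; unfold Re, Im; simpl; ring).
eapply Rle_trans; [apply Cmod_triangle|].
rewrite Cmod_mult, Cmod_Ci, !Cmod_R; lra.
Qed.

Lemma is_Cseries_intro (a : nat -> C) (l : C) (e : nat -> R) :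
  (forall n, (Cmod (l - sum_n a n) <= e n)%R) -> is_lim_seq e 0 -> is_series a l.
Proof.
intros H He; apply filterlim_locally_ball_norm; intros eps.
apply is_lim_seq_spec in He; destruct (He eps) as [N HN].
exists N; intros n Hn; unfold ball_norm.
change (norm (minus (sum_n a n) l)) with (Cmod (sum_n a n - l)).
rewrite <- Cmod_opp.
replace (- (sum_n a n - l)) with (l - sum_n a n) by ring.
eapply Rle_lt_trans; [apply H|].
specialize (HN n Hn); rewrite Rminus_0_r in HN.
eapply Rle_lt_trans; [apply Rle_abs | exact HN].
Qed.

(* Along [s -> Sum_(k <= n) ((1 - s) z)^k / k! * Cexp (s z)], which joins the
   Taylor polynomial to [Cexp z], the derivative telescopes to
   [z ((1 - s) z)^n / n! * Cexp (s z)]. *)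
Lemma Cexp_taylor (z : C) (n : nat) :
  (Cmod (Cexp z - sum_n (fun k => z ^ k / RtoC (INR (fact k)))%C n)
   <= 2 * (Cmod z * exp (Rabs (Re z)) * (Cmod z ^ n / INR (fact n))))%R.
Proof.
pose (T := fun (s : R) (k : nat) => ((1 - RtoC s) * z) ^ k / RtoC (INR (fact k))).
pose (f := fun s : R => sum_n (T s) n * Cexp (RtoC s * z)).
pose (df := fun s : R => z * T s n * Cexp (RtoC s * z)).
assert (Dl : forall s, is_Cderive (fun s => (1 - RtoC s) * z) s (- z)).
{ intros s.
  apply is_Cderive_ext with (fun s => z + (- z) * RtoC s); [intros; ring|].
  eapply is_Cderive_eq.
  - apply is_Cderive_plus; [apply is_Cderive_const|].
    apply (is_Cderive_mult (fun _ => - z));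
      [apply is_Cderive_const | apply is_Cderive_RtoC].
  - ring. }
assert (De : forall s, is_Cderive (fun s => Cexp (RtoC s * z)) s (z * Cexp (RtoC s * z))).
{ intros s; apply is_Cderive_Cexp.
  eapply is_Cderive_eq.
  - apply (is_Cderive_mult RtoC (fun _ => z));
      [apply is_Cderive_RtoC | apply is_Cderive_const].
  - simpl; ring. }
assert (DT : forall s, is_Cderive (fun s => sum_n (T s) n) s (- z * (sum_n (T s) n - T s n))).
{ intros s; clear f df; induction n as [|n IH].
  - apply is_Cderive_ext with (fun _ => 1).
    + intros t; rewrite sum_O; unfold T; simpl; field.
    + rewrite sum_O; replace (- z * (T s O - T s O)) with (RtoC 0) by ring.
      apply is_Cderive_const.
  - apply is_Cderive_ext with (fun s => sum_n (T s) n + T s (S n)).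
    { intros t; now rewrite sum_Sn. }
    rewrite sum_Sn.
    replace (- z * (plus (sum_n (T s) n) (T s (S n)) - T s (S n)))
      with (- z * (sum_n (T s) n - T s n) + (- z * T s n))
      by (change plus with Cplus; ring).
    apply is_Cderive_plus; [exact IH|].
    apply is_Cderive_ext
      with (fun s => / RtoC (INR (fact (S n))) * ((1 - RtoC s) * z) ^ S n).
    { intros t; unfold T, Cdiv; ring. }
    replace (- z * T s n) with (0 * ((1 - RtoC s) * z) ^ S n
      + / RtoC (INR (fact (S n))) * (RtoC (INR (S n)) * ((1 - RtoC s) * z) ^ n * (- z))).
    + apply (is_Cderive_mult (fun _ => / RtoC (INR (fact (S n)))));
        [apply is_Cderive_const | now apply is_Cderive_pow].
    + unfold T; rewrite RtoC_fact_S; field.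
      split; [apply INR_fact_neq_0_C | apply INR_S_neq_0_C]. }
replace (Cexp z - sum_n (fun k => z ^ k / RtoC (INR (fact k))) n) with (f 1%R - f 0%R).
- apply Cmod_increment_le with df.
  + intros s; unfold f, df.
    replace (z * T s n * Cexp (RtoC s * z))
      with (- z * (sum_n (T s) n - T s n) * Cexp (RtoC s * z)
            + sum_n (T s) n * (z * Cexp (RtoC s * z))) by ring.
    apply (is_Cderive_mult (fun s => sum_n (T s) n)); [apply DT | apply De].
  + intros s Hs; unfold df, T.
    rewrite !Cmod_mult, Cmod_Cexp, Rmult_assoc, Rmult_assoc.
    apply Rmult_le_compat_l; [apply Cmod_ge_0|].
    rewrite (Rmult_comm _ (exp (Re (s * z)))).
    apply Rmult_le_compat.
    * apply Rlt_le, exp_pos.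
    * apply Cmod_ge_0.
    * rewrite re_scal_l.
      (* Since [0 <= s <= 1], this holds for either sign of [Re z]. The strict and equality cases
         are separated because [exp_increasing] is strict. *)
      assert (s * Re z <= Rabs (Re z))%R as [H | H].
      { destruct (Rle_or_lt 0 (Re z)) as [P | P].
        - rewrite Rabs_pos_eq by easy; nra.
        - rewrite Rabs_left by easy; nra. }
      -- now apply Rlt_le, exp_increasing.
      -- rewrite H; apply Rle_refl.
    * rewrite Cmod_div, Cmod_R, (Rabs_pos_eq (INR (fact n)))
        by (apply INR_fact_neq_0_C || apply pos_INR).
      apply Rmult_le_compat_r.
      { apply Rlt_le, Rinv_0_lt_compat, INR_fact_lt_0. }
      rewrite Cmod_pow; apply pow_incr; split; [apply Cmod_ge_0|].
      rewrite Cmod_mult, <- RtoC_minus, Cmod_R, Rabs_pos_eq by lra.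
      rewrite <- (Rmult_1_l (Cmod z)) at 2.
      apply Rmult_le_compat_r; [apply Cmod_ge_0 | lra].
- unfold f.
  rewrite (Cmult_0_l z), Cexp_0, Cmult_1_l, Cmult_1_r.
  f_equal.
  (* At [s = 1] only the term [k = 0] survives, with [0 ^ 0 = 1]; at [s = 0] the path starts from
     the Taylor polynomial. *)
  + replace (sum_n (T 1%R) n) with (RtoC 1); [ring|].
    symmetry; clear f df DT; induction n as [|n IH].
    * rewrite sum_O; unfold T; simpl; field.
    * rewrite sum_Sn, IH.
      change plus with Cplus; unfold T; simpl Cpow.
      unfold Cdiv; ring.
  + apply sum_n_ext; intros k; unfold T; f_equal.
    now replace ((1 - 0) * z) with z by ring.
Qed.

Lemma is_series_Cexp (z : C) :
  is_series (fun n => z ^ n / RtoC (INR (fact n))) (Cexp z).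
Proof.
eapply is_Cseries_intro; [apply Cexp_taylor|].
set (K := (Cmod z * exp (Rabs (Re z)))%R).
apply is_lim_seq_ext with (fun n => (2 * K) * (Cmod z ^ n / INR (fact n)))%R.
{ intros n; simpl; ring. }
replace (Finite 0) with (Rbar_mult (2 * K)%R (Finite 0)) by (simpl; f_equal; ring).
apply is_lim_seq_scal_l, is_lim_seq_Reals, cv_speed_pow_fact.
Qed.

(** * Double series with a majorant *)

Lemma is_Cseries_lim (a : nat -> C) (l : C) :
  is_series a l -> is_lim_seq (fun n => Cmod (l - sum_n a n)) 0.
Proof.
intros H; apply is_lim_seq_spec; intros eps.
apply filterlim_locally_ball_norm with (eps := eps) in H; destruct H as [N HN].
exists N; intros n Hn.
rewrite Rminus_0_r, Rabs_pos_eq by apply Cmod_ge_0.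
rewrite <- Cmod_opp; replace (- (l - sum_n a n)) with (sum_n a n - l) by ring.
exact (HN n Hn).
Qed.

Lemma Re_sum_n (a : nat -> C) (n : nat) :
  Re (sum_n a n) = sum_n (fun k => Re (a k)) n.
Proof.
induction n as [|n IH]; [now rewrite !sum_O|].
now rewrite !sum_Sn, <- IH.
Qed.

Lemma is_series_Re (a : nat -> C) (l : C) :
  is_series a l -> is_series (fun n => Re (a n)) (Re l).
Proof.
intros H; apply is_Cseries_lim in H.
apply filterlim_locally; intros eps.
apply is_lim_seq_spec in H; destruct (H eps) as [N HN].
exists N; intros n Hn; specialize (HN n Hn).
rewrite Rminus_0_r, Rabs_pos_eq in HN by apply Cmod_ge_0.
change (Rabs (sum_n (fun k => Re (a k)) n - Re l) < eps)%R.
rewrite <- Re_sum_n, Rabs_minus_sym.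
eapply Rle_lt_trans; [|exact HN].
eapply Rle_trans; [|apply re_le_Cmod].
unfold Cminus; rewrite re_plus, re_opp; apply Rle_refl.
Qed.

Lemma Cmod_sum_n_le (a : nat -> C) (r : nat -> R) (n : nat) :
  (forall k, (k <= n)%nat -> (Cmod (a k) <= r k)%R) ->
  (Cmod (sum_n a n) <= sum_n r n)%R.
Proof.
induction n as [|n IH]; intros H.
- rewrite !sum_O; now apply H.
- rewrite !sum_Sn.
  eapply Rle_trans; [apply Cmod_triangle|].
  apply Rplus_le_compat; [apply IH; intros k Hk|]; apply H; lia.
Qed.

Lemma sum_n_le_loc (a b : nat -> R) (n : nat) :
  (forall k, (k <= n)%nat -> (a k <= b k)%R) -> (sum_n a n <= sum_n b n)%R.
Proof.
induction n as [|n IH]; intros H.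
- rewrite !sum_O; now apply H.
- rewrite !sum_Sn.
  apply Rplus_le_compat; [apply IH; intros k Hk|]; apply H; lia.
Qed.

Lemma sum_n_nonneg_incr (r : nat -> R) (n m : nat) :
  (forall k, (0 <= r k)%R) -> (n <= m)%nat -> (sum_n r n <= sum_n r m)%R.
Proof.
intros H; induction 1 as [|m _ IH]; [apply Rle_refl|].
rewrite sum_Sn; specialize (H (S m)); change plus with Rplus; lra.
Qed.

(** The bound holds between the partial sums up to [N] and [N + k], by the triangle inequality, and
    passes to the limit in [k]. *)
Lemma series_tail_le (a : nat -> C) (r : nat -> R) (l : C) (s : R) (N : nat) :
  (forall n, (Cmod (a n) <= r n)%R) -> is_series a l -> is_series r s ->
  (Cmod (l - sum_n a N) <= s - sum_n r N)%R.
Proof.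
intros H Ha Hr.
assert (A : forall k, (Cmod (sum_n a (N + k) - sum_n a N)
                       <= sum_n r (N + k) - sum_n r N)%R).
{ induction k as [|k IH].
  - rewrite Nat.add_0_r; replace (sum_n a N - sum_n a N) with (RtoC 0) by ring.
    rewrite Cmod_0; lra.
  - rewrite Nat.add_succ_r, !sum_Sn.
    change plus with Cplus at 1; change plus with Rplus.
    replace (sum_n a (N + k) + a (S (N + k)) - sum_n a N)
      with ((sum_n a (N + k) - sum_n a N) + a (S (N + k))) by ring.
    eapply Rle_trans; [apply Cmod_triangle|].
    specialize (H (S (N + k))); lra. }
(* With a left side constant in [k], only known limits remain on the right: the error of [a], which
   tends to 0, and the partial sums of [r]. *)
assert (B : forall k, (Cmod (l - sum_n a N)
  <= Cmod (l - sum_n a (k + N)%nat) + (sum_n r (k + N)%nat - sum_n r N))%R).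
{ intros k; rewrite (Nat.add_comm k N).
  replace (l - sum_n a N)
    with ((l - sum_n a (N + k)) + (sum_n a (N + k) - sum_n a N)) by ring.
  eapply Rle_trans; [apply Cmod_triangle|]; specialize (A k); lra. }
apply (is_lim_seq_le _ _ (Finite (Cmod (l - sum_n a N)))
         (Finite (s - sum_n r N)) B (is_lim_seq_const _)).
replace (s - sum_n r N)%R with (0 + (s - sum_n r N))%R by ring.
apply is_lim_seq_plus'.
- apply (is_lim_seq_incr_n (fun k => Cmod (l - sum_n a k)) N), is_Cseries_lim, Ha.
- apply is_lim_seq_minus'; [|apply is_lim_seq_const].
  apply (is_lim_seq_incr_n (fun k => sum_n r k) N); exact Hr.
Qed.

Section Majorized.

(** [T] and [Tr] collect the inner sums over [m]. Only an iterated sum is assumed for the majorant: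
    its terms being nonnegative, this controls the sum over any finite region. *)
Variables (t : nat -> nat -> C) (T : nat -> C) (L : C).
Variables (r : nat -> nat -> R) (Tr : nat -> R) (Lr : R).
Hypothesis (Htr : forall m n, (Cmod (t m n) <= r m n)%R).
Hypothesis (Ht : forall n, is_series (fun m => t m n) (T n)) (HS : is_series T L).
Hypothesis (Hr : forall n, is_series (fun m => r m n) (Tr n)) (HTr : is_series Tr Lr).

(** The missing terms are the outer tail plus the inner tails, each bounded by the corresponding
    tail of the majorant. The cut [M n] may vary with [n], to cover both rectangles ([M] constant)
    and triangles ([M n = N - n]). *)
Lemma majorized_error_le (M : nat -> nat) (N : nat) :
  (Cmod (L - sum_n (fun n => sum_n (fun m => t m n) (M n)) N)
   <= Lr - sum_n (fun n => sum_n (fun m => r m n) (M n)) N)%R.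
Proof.
assert (HT : forall n K, (Cmod (T n - sum_n (fun m => t m n) K)
                          <= Tr n - sum_n (fun m => r m n) K)%R).
{ intros n K; now apply (series_tail_le (fun m => t m n) (fun m => r m n)). }
assert (HSS : forall n, (Cmod (T n) <= Tr n)%R).
{ intros n; specialize (HT n O); rewrite !sum_O in HT.
  replace (T n) with ((T n - t O n) + t O n) by ring.
  eapply Rle_trans; [apply Cmod_triangle|]; specialize (Htr O n); lra. }
assert (H1 := series_tail_le T Tr L Lr N HSS HS HTr).
assert (H2 := Cmod_sum_n_le (fun n => T n - sum_n (fun m => t m n) (M n))
  (fun n => Tr n - sum_n (fun m => r m n) (M n))%R N (fun n _ => HT n (M n))).
replace (L - sum_n (fun n => sum_n (fun m => t m n) (M n)) N)
  with ((L - sum_n T N) + sum_n (fun n => T n - sum_n (fun m => t m n) (M n)) N).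
- replace (Lr - sum_n (fun n => sum_n (fun m => r m n) (M n)) N)%R
    with ((Lr - sum_n Tr N) + sum_n (fun n => Tr n - sum_n (fun m => r m n) (M n)) N)%R.
  + eapply Rle_trans; [apply Cmod_triangle|]; lra.
  + clear; induction N as [|N IH]; [rewrite !sum_O; ring|].
    rewrite !sum_Sn; change plus with Rplus in *; lra.
- clear; induction N as [|N IH]; [rewrite !sum_O; ring|].
  rewrite !sum_Sn; change plus with Cplus in *.
  replace (L - (sum_n (fun n => sum_n (fun m => t m n) (M n)) N
                + sum_n (fun m => t m (S N)) (M (S N))))
    with (L - sum_n (fun n => sum_n (fun m => t m n) (M n)) N
          - sum_n (fun m => t m (S N)) (M (S N))) by ring.
  rewrite <- IH; ring.
Qed.

Lemma majorized_sum_le (M : nat -> nat) (N : nat) :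
  (sum_n (fun n => sum_n (fun m => r m n) (M n)) N <= Lr)%R.
Proof.
assert (H := majorized_error_le M N); assert (H' := Cmod_ge_0
  (L - sum_n (fun n => sum_n (fun m => t m n) (M n)) N)); lra.
Qed.

(** A finite rectangle carries the sum of the majorant up to [eps]: half is spent on truncating [n]
    at [N0], half on truncating [m] at [M0] in the finitely many inner sums left. Nonnegativity
    extends the bound to every larger region. *)
Lemma majorized_error_lt (eps : posreal) :
  exists N0 M0 : nat, forall (N : nat) (M : nat -> nat),
    (N0 <= N)%nat -> (forall n, (n <= N0)%nat -> (M0 <= M n)%nat) ->
    (Cmod (L - sum_n (fun n => sum_n (fun m => t m n) (M n)) N) < eps)%R.
Proof.
assert (Hpos : forall m n, (0 <= r m n)%R).
{ intros m n; eapply Rle_trans; [apply Cmod_ge_0 | apply Htr]. }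
assert (HL : is_lim_seq (sum_n Tr) Lr) by exact HTr.
apply is_lim_seq_spec in HL; destruct (HL (pos_div_2 eps)) as [N0 HN0].
specialize (HN0 N0 (Nat.le_refl _)); simpl in HN0.
assert (HC : is_lim_seq (fun K => sum_n (fun n => sum_n (fun m => r m n) K) N0)
               (sum_n Tr N0)).
{ clear - Hr; induction N0 as [|N IH].
  - rewrite sum_O.
    apply is_lim_seq_ext with (fun K => sum_n (fun m => r m O) K).
    + intros K; now rewrite sum_O.
    + exact (Hr O).
  - rewrite sum_Sn.
    apply is_lim_seq_ext with (fun K => sum_n (fun n => sum_n (fun m => r m n) K) N
                                 + sum_n (fun m => r m (S N)) K)%R.
    + intros K; now rewrite sum_Sn.
    + apply is_lim_seq_plus'; [exact IH | exact (Hr (S N))]. }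
apply is_lim_seq_spec in HC; destruct (HC (pos_div_2 eps)) as [M0 HM0].
specialize (HM0 M0 (Nat.le_refl _)); simpl in HM0.
exists N0, M0; intros N M HN HM.
eapply Rle_lt_trans; [apply majorized_error_le|].
assert (H1 : (sum_n (fun n => sum_n (fun m => r m n) M0) N0
              <= sum_n (fun n => sum_n (fun m => r m n) (M n)) N0)%R).
{ apply sum_n_le_loc; intros n Hn; apply sum_n_nonneg_incr; auto. }
assert (H2 : (sum_n (fun n => sum_n (fun m => r m n) (M n)) N0
              <= sum_n (fun n => sum_n (fun m => r m n) (M n)) N)%R).
{ apply sum_n_nonneg_incr; [|easy]; intros k.
  apply Rle_trans with (sum_n (fun m => r m k) O).
  - rewrite sum_O; apply Hpos.
  - apply sum_n_nonneg_incr; [auto | lia]. }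
apply Rabs_def2 in HN0; apply Rabs_def2 in HM0; lra.
Qed.

Lemma majorized_double_series : is_double_series t L.
Proof.
split.
- exists Lr; intros M N; rewrite sum_n_switch.
  eapply Rle_trans; [|apply (majorized_sum_le (fun _ => M) N)].
  apply sum_n_le_loc; intros n _; apply sum_n_le_loc; intros m _; apply Htr.
- apply (filterlim_locally_ball_norm (K := C_AbsRing) (U := C_NormedModule)); intros eps.
  destruct (majorized_error_lt eps) as [N0 [M0 H]].
  exists (fun m => M0 <= m)%nat (fun n => N0 <= n)%nat.
  + now exists M0.
  + now exists N0.
  + intros M N HM HN; simpl; rewrite sum_n_switch.
    change (Cmod (sum_n (fun n => sum_n (fun m => t m n) M) N - L) < eps)%R.
    rewrite <- Cmod_opp.
    replace (- (sum_n (fun n => sum_n (fun m => t m n) M) N - L))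
      with (L - sum_n (fun n => sum_n (fun m => t m n) M) N) by ring.
    now apply (H N (fun _ => M)).
Qed.

Lemma sum_n_triangle (N : nat) :
  sum_n (fun n => sum_n (fun m => t m n) (N - n)) N
  = sum_n (fun k => sum_n (fun n => t (k - n)%nat n) k) N.
Proof.
induction N as [|N IH]; [now rewrite !sum_O|].
(* Passing to [N + 1] adds one term to each inner sum with [n <= N], and a new inner sum with a
   single term; together they form the antidiagonal [k = N + 1]. *)
rewrite (sum_Sn (fun k => sum_n (fun n => t (k - n)%nat n) k)), <- IH.
rewrite !sum_Sn, Nat.sub_diag, sum_O.
change plus with Cplus; rewrite Cplus_assoc; f_equal.
change Cplus with (@plus C_AbelianMonoid); rewrite <- sum_n_plus.
apply sum_n_ext_loc; intros n Hn.
now rewrite Nat.sub_succ_l, sum_Sn.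
Qed.

Lemma majorized_diagonal_series :
  is_series (fun k => sum_n (fun n => t (k - n)%nat n) k) L.
Proof.
apply filterlim_locally_ball_norm; intros eps.
destruct (majorized_error_lt eps) as [N0 [M0 H]].
(* From this size on, the triangle [m + n <= N] contains the rectangle [n <= N0], [m <= M0]. *)
exists (N0 + M0)%nat; intros N HN.
change (Cmod (sum_n (fun k => sum_n (fun n => t (k - n)%nat n) k) N - L) < eps)%R.
rewrite <- Cmod_opp, <- sum_n_triangle.
replace (- (sum_n (fun n => sum_n (fun m => t m n) (N - n)) N - L))
  with (L - sum_n (fun n => sum_n (fun m => t m n) (N - n)) N) by ring.
apply (H N (fun n => N - n)%nat); [|intros n Hn]; lia.
Qed.

End Majorized.

(** * Negative binomial and Laguerre series *)

(* Coquelicot's lemmas may leave an equation typed in a structure over [C],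
   where [ring] does not recognize it. *)
Ltac Cring := match goal with |- @eq _ ?a ?b => change (@eq C a b); ring end.

(** The bound [y] is a complex number with zero imaginary part, not a real, so that one expression
    over [C], taken at the parameters and at their moduli, gives both the terms and their
    majorants. *)
Definition maj (x y : C) : Prop := Im y = 0%R /\ (Cmod x <= Re y)%R.

Lemma maj_Cmod (x : C) : maj x (RtoC (Cmod x)).
Proof. split; [easy | apply Rle_refl]. Qed.

Lemma maj_RtoC (r : R) : (0 <= r)%R -> maj (RtoC r) (RtoC r).
Proof.
intros H; split; [easy|]; rewrite Cmod_R, Rabs_pos_eq by easy; apply Rle_refl.
Qed.

Lemma maj_plus (x y x' y' : C) : maj x y -> maj x' y' -> maj (x + x') (y + y').
Proof.
intros [H1 H2] [H3 H4]; split.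
- rewrite im_plus, H1, H3; ring.
- rewrite re_plus; eapply Rle_trans; [apply Cmod_triangle | lra].
Qed.

Lemma maj_mult (x y x' y' : C) : maj x y -> maj x' y' -> maj (x * x') (y * y').
Proof.
intros [H1 H2] [H3 H4]; unfold maj; rewrite Cmod_mult, re_mult, im_mult, H1, H3.
split; [ring|].
replace (Re y * Re y' - 0 * 0)%R with (Re y * Re y')%R by ring.
apply Rmult_le_compat; auto using Cmod_ge_0.
Qed.

Lemma maj_pow (x y : C) (n : nat) : maj x y -> maj (x ^ n) (y ^ n).
Proof.
intros H; induction n as [|n IH]; simpl; [apply maj_RtoC; lra | now apply maj_mult].
Qed.

Lemma maj_div (x y : C) (r : R) : (0 < r)%R -> maj x y -> maj (x / RtoC r) (y / RtoC r).
Proof.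
intros Hr H; apply maj_mult; [easy|].
rewrite <- RtoC_inv by lra; apply maj_RtoC, Rlt_le, Rinv_0_lt_compat, Hr.
Qed.

Lemma maj_INR (n : nat) : maj (RtoC (INR n)) (RtoC (INR n)).
Proof. apply maj_RtoC, pos_INR. Qed.

Lemma sum_n_shift (f : nat -> C) (n : nat) :
  sum_n f (S n) = f O + sum_n (fun k => f (S k)) n.
Proof.
induction n as [|n IH].
- now rewrite sum_Sn, !sum_O.
- rewrite sum_Sn, IH, sum_Sn; symmetry; apply Cplus_assoc.
Qed.

Lemma sum_n_rev (f : nat -> C) (n : nat) : sum_n (fun k => f (n - k)%nat) n = sum_n f n.
Proof.
induction n as [|n IH]; [now rewrite !sum_O|].
rewrite sum_n_shift, sum_Sn, Nat.sub_0_r; change plus with Cplus.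
rewrite Cplus_comm; f_equal; rewrite <- IH; reflexivity.
Qed.

Lemma is_series_finite (f : nat -> C) (l : C) (n : nat) :
  (forall k, (n < k)%nat -> f k = 0) -> is_series f l -> l = sum_n f n.
Proof.
intros H Hf; apply is_Cseries_lim in Hf.
assert (E : forall k, (n <= k)%nat -> sum_n f k = sum_n f n).
{ induction 1 as [|k Hk IH]; [easy|].
  rewrite sum_Sn, IH, H by lia; apply Cplus_0_r. }
apply Ceq_minus, Cmod_eq_0.
assert (Hc : is_lim_seq (fun _ => Cmod (l - sum_n f n)) 0).
{ apply is_lim_seq_ext_loc with (2 := Hf).
  exists n; intros k Hk; now rewrite E. }
apply is_lim_seq_unique in Hc; rewrite Lim_seq_const in Hc; now injection Hc.
Qed.

Lemma one_minus_neq_0 (q : C) : (Cmod q < 1)%R -> 1 - q <> 0.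
Proof.
intros Hq E; apply Ceq_minus in E; rewrite <- E, Cmod_1 in Hq; lra.
Qed.

Lemma is_Cseries_geom (q : C) :
  (Cmod q < 1)%R -> is_series (fun j => q ^ j) (/ (1 - q)).
Proof.
intros Hq.
assert (Hq1 := one_minus_neq_0 q Hq).
apply is_Cseries_intro with (fun n => (Cmod q * / Cmod (1 - q)) * Cmod q ^ n)%R.
- intros n.
  replace (/ (1 - q) - sum_n (fun j => q ^ j) n) with (q * / (1 - q) * q ^ n).
  { rewrite !Cmod_mult, Cmod_inv, Cmod_pow by easy; apply Rle_refl. }
  induction n as [|n IH].
  + rewrite sum_O; simpl; now field.
  + rewrite sum_Sn; change plus with Cplus.
    replace (/ (1 - q) - (sum_n (fun j => q ^ j) n + q ^ S n))
      with (/ (1 - q) - sum_n (fun j => q ^ j) n - q ^ S n) by ring.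
    rewrite <- IH; simpl; now field.
- replace (Finite 0) with (Rbar_mult (Cmod q * / Cmod (1 - q))%R (Finite 0))
    by (simpl; f_equal; ring).
  apply is_lim_seq_scal_l, is_lim_seq_geom.
  now rewrite Rabs_pos_eq by apply Cmod_ge_0.
Qed.

Lemma Cmod_RtoC_Cmod (q : C) : Cmod (RtoC (Cmod q)) = Cmod q.
Proof. rewrite Cmod_R; apply Rabs_pos_eq, Cmod_ge_0. Qed.

(** The binomial coefficient [C(p + j, j)], which is the coefficient of [q ^ j] in
    [1 / (1 - q) ^ (p + 1)]. *)
Definition binomR (p j : nat) : R := (INR (fact (p + j)) / (INR (fact p) * INR (fact j)))%R.

Lemma binomR_nonneg (p j : nat) : (0 <= binomR p j)%R.
Proof.
apply Rlt_le, Rdiv_lt_0_compat; [|apply Rmult_lt_0_compat]; apply INR_fact_lt_0.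
Qed.

Lemma binomR_hockey_stick (p k : nat) :
  sum_n (fun j => RtoC (binomR p j)) k = RtoC (binomR (S p) k).
Proof.
unfold binomR; induction k as [|k IH].
- rewrite sum_O, !Nat.add_0_r; f_equal; field.
  repeat split; apply INR_fact_neq_0.
- rewrite sum_Sn, IH; change plus with Cplus; rewrite <- RtoC_plus; f_equal.
  replace (S p + S k)%nat with (S (S (p + k))) by lia.
  replace (p + S k)%nat with (S (p + k)) by lia.
  replace (S p + k)%nat with (S (p + k)) by lia.
  rewrite (fact_simpl (S (p + k))), (fact_simpl k), (fact_simpl p).
  rewrite !mult_INR, !S_INR, plus_INR; field.
  repeat split; try apply INR_fact_neq_0; rewrite <- S_INR; now apply not_0_INR.
Qed.

Lemma is_Cseries_scal (c : C) (a : nat -> C) (l : C) :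
  is_series a l -> is_series (fun n => c * a n) (c * l).
Proof. exact (is_series_scal (K := C_AbsRing) (V := C_NormedModule) c a l). Qed.

Lemma is_Cseries_plus (a b : nat -> C) (l k : C) :
  is_series a l -> is_series b k -> is_series (fun n => a n + b n) (l + k).
Proof. exact (is_series_plus (K := C_AbsRing) (V := C_NormedModule) a b l k). Qed.

Lemma is_Cseries_eq (a b : nat -> C) (l k : C) :
  (forall n, a n = b n) -> l = k -> is_series a l -> is_series b k.
Proof. intros E <-; now apply is_series_ext. Qed.

(** Induction on [p]: multiplying by one more geometric series is a Cauchy product, read off along
    diagonals, whose coefficients are summed by the hockey-stick identity. *)
Lemma is_series_neg_binomial (p : nat) (q : C) :
  (Cmod q < 1)%R ->
  is_series (fun j => RtoC (binomR p j) * q ^ j) (/ (1 - q) ^ S p).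
Proof.
revert q; induction p as [|p IH]; intros q Hq.
- apply is_Cseries_eq with (3 := is_Cseries_geom q Hq).
  + intros j; unfold binomR; simpl (0 + j)%nat; simpl (fact 0).
    replace (INR (fact j) / (INR 1 * INR (fact j)))%R with 1%R; [ring|].
    simpl; field; apply INR_fact_neq_0.
  + f_equal; simpl; ring.
(* Stated for arbitrary [x], to serve at [q] for the terms and at [Cmod q] for the majorant. *)
- assert (I : forall x, (Cmod x < 1)%R ->
    (forall n, is_series (fun m => RtoC (binomR p m) * x ^ m * x ^ n)
                 (x ^ n * / (1 - x) ^ S p)) /\
    is_series (fun n => x ^ n * / (1 - x) ^ S p) (/ (1 - x) ^ S (S p))).
  { intros x Hx; assert (Hx1 := one_minus_neq_0 x Hx); split.
    - intros n; eapply is_Cseries_eq with (3 := is_Cseries_scal (x ^ n) _ _ (IH x Hx)).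
      + intros m; simpl; ring.
      + easy.
    - eapply is_Cseries_eq
        with (3 := is_Cseries_scal (/ (1 - x) ^ S p) _ _ (is_Cseries_geom x Hx)).
      + intros m; simpl; ring.
      + rewrite (Cpow_S _ (S p)); field.
        split; [now apply Cpow_nz | easy]. }
  destruct (I q Hq) as [I1 I2].
  destruct (I (RtoC (Cmod q))) as [J1 J2]; [now rewrite Cmod_RtoC_Cmod|].
  apply is_Cseries_eq
    with (a := fun k => sum_n (fun n => RtoC (binomR p (k - n)) * q ^ (k - n) * q ^ n) k)
         (l := / (1 - q) ^ S (S p)); [intros k | easy |].
  + rewrite (sum_n_ext_loc _ (fun n => (fun m => q ^ k * RtoC (binomR p m)) (k - n)%nat)).
    * rewrite (sum_n_rev (fun m => q ^ k * RtoC (binomR p m))).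
      rewrite (sum_n_mult_l (K := C_Ring) (q ^ k)), binomR_hockey_stick.
      apply Cmult_comm.
    * intros n Hn; replace k with (k - n + n)%nat at 3 by lia.
      rewrite Cpow_add_r; Cring.
  + refine (majorized_diagonal_series _ _ _ _ _ _ _ I1 I2
      (fun n => is_series_Re _ _ (J1 n)) (is_series_Re _ _ J2)).
    intros m n; cbv beta.
    (* The goal is the second half of a [maj] statement, which [apply] reaches through the
       conjunction. *)
    repeat apply maj_mult;
      auto using maj_pow, maj_Cmod, maj_RtoC, binomR_nonneg.
Qed.

(** For fixed [p], the sum over [j = k - p] is a negative binomial series; the sum over [p] is then
    an exponential series at [X / (1 - q)]. For [q <> 0], the term of index [k] is [q ^ k] times the
    Laguerre polynomial [L_k] at [- X / q]. *)
Lemma is_series_laguerre (q X : C) :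
  (Cmod q < 1)%R ->
  is_series (fun k => sum_n (fun p =>
      RtoC (binomR p (k - p)) * q ^ (k - p) * (X ^ p / RtoC (INR (fact p)))) k)
    (/ (1 - q) * Cexp (X / (1 - q))).
Proof.
intros Hq.
assert (I : forall x Y, (Cmod x < 1)%R ->
  (forall p, is_series (fun j => RtoC (binomR p j) * x ^ j * (Y ^ p / RtoC (INR (fact p))))
               (Y ^ p / RtoC (INR (fact p)) * / (1 - x) ^ S p)) /\
  is_series (fun p => Y ^ p / RtoC (INR (fact p)) * / (1 - x) ^ S p)
    (/ (1 - x) * Cexp (Y / (1 - x)))).
{ intros x Y Hx; assert (Hx1 := one_minus_neq_0 x Hx); split.
  - intros p; eapply is_Cseries_eq
      with (3 := is_Cseries_scal (Y ^ p / RtoC (INR (fact p))) _ _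
                   (is_series_neg_binomial p x Hx)); [intros j; ring | easy].
  - eapply is_Cseries_eq
      with (3 := is_Cseries_scal (/ (1 - x)) _ _ (is_series_Cexp (Y / (1 - x))));
      [intros p | easy].
    unfold Cdiv; rewrite Cpow_mult_l, Cpow_inv by easy; rewrite Cpow_S.
    field; auto using INR_fact_neq_0_C, Cpow_nz. }
destruct (I q X Hq) as [I1 I2].
destruct (I (RtoC (Cmod q)) (RtoC (Cmod X))) as [J1 J2]; [now rewrite Cmod_RtoC_Cmod|].
refine (majorized_diagonal_series
  (fun j p => RtoC (binomR p j) * q ^ j * (X ^ p / RtoC (INR (fact p))))
  _ _ _ _ _ _ I1 I2
  (fun n => is_series_Re _ _ (J1 n)) (is_series_Re _ _ J2)).
intros m n; cbv beta.
apply maj_mult; [apply maj_mult | apply maj_div; [apply INR_fact_lt_0|]];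
  auto using maj_pow, maj_Cmod, maj_RtoC, binomR_nonneg.
Qed.

(** * Hermite polynomials with independent parameters *)

(* [herm c a b m n = Sum_k C(m,k) C(n,k) k! c^k a^(m-k) b^(n-k)]. The junk value
   [0 - 1 = 0] of the index is multiplied by [INR 0]. *)
Fixpoint herm (c a b : C) (m n : nat) : C :=
  match m with
  | O => b ^ n
  | S m => a * herm c a b m n + RtoC (INR n) * c * herm c a b m (n - 1)
  end.

Lemma herm_S_l (c a b : C) (m n : nat) :
  herm c a b (S m) n = a * herm c a b m n + RtoC (INR n) * c * herm c a b m (n - 1).
Proof. reflexivity. Qed.

Lemma herm_0_r (c a b : C) (m : nat) : herm c a b m 0 = a ^ m.
Proof. induction m as [|m IH]; [easy|]; rewrite herm_S_l, IH; simpl; ring. Qed.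

(** Although the definition recurses on [m] only, [herm] is symmetric under exchanging [a], [m] with
    [b], [n]; this is the mirror image of the defining recursion. *)
Lemma herm_S_r (c a b : C) (m n : nat) :
  herm c a b m (S n) = b * herm c a b m n + RtoC (INR m) * c * herm c a b (m - 1) n.
Proof.
revert n; induction m as [|m IH]; intros n; [simpl; ring|].
replace (S m - 1)%nat with m by lia.
rewrite !herm_S_l, IH; replace (S n - 1)%nat with n by lia; rewrite !RtoC_INR_S.
(* [K1] and [K2] lower one index each. Their factors [INR m] and [INR n] vanish at 0, where the
   truncated index [0 - 1] would be wrong. *)
assert (K1 : RtoC (INR m) * herm c a b m n =
  RtoC (INR m) * (a * herm c a b (m - 1) n
                  + RtoC (INR n) * c * herm c a b (m - 1) (n - 1))).
{ destruct m as [|k]; [simpl; ring|].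
  rewrite herm_S_l; now replace (S k - 1)%nat with k by lia. }
assert (K2 : RtoC (INR n) * herm c a b m n =
  RtoC (INR n) * (b * herm c a b m (n - 1)
                  + RtoC (INR m) * c * herm c a b (m - 1) (n - 1))).
{ destruct n as [|p]; [simpl; ring|].
  rewrite IH; now replace (S p - 1)%nat with p by lia. }
apply Ceq_minus in K1; apply Ceq_minus in K2; apply Ceq_minus.
(* The difference of the two sides is [c] times [K2] minus [K1], in which the terms with both
   indices lowered cancel. *)
transitivity (c * (RtoC 0 - RtoC 0)); [rewrite <- K2 at 1; rewrite <- K1|]; ring.
Qed.

(** As a polynomial in [c], [a] and [b], [herm] has nonnegative coefficients, so majorants pass
    through it. *)
Lemma herm_maj (c a b c' a' b' : C) (m n : nat) :
  maj c c' -> maj a a' -> maj b b' -> maj (herm c a b m n) (herm c' a' b' m n).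
Proof.
intros Hc Ha Hb; revert n; induction m as [|m IH]; intros n; simpl.
- now apply maj_pow.
- apply maj_plus; repeat apply maj_mult; auto using maj_INR.
Qed.

(** * Exponential generating functions in the index [m] *)

Definition egf (u : C) (f : nat -> C) (l : C) : Prop :=
  is_series (fun m => u ^ m / RtoC (INR (fact m)) * f m) l.

Lemma egf_ext (u : C) (f g : nat -> C) (l k : C) :
  (forall m, f m = g m) -> l = k -> egf u f l -> egf u g k.
Proof.
intros E El; apply is_Cseries_eq; [intros m; now rewrite E | exact El].
Qed.

Lemma egf_plus (u : C) (f g : nat -> C) (l k : C) :
  egf u f l -> egf u g k -> egf u (fun m => f m + g m) (l + k).
Proof.
intros H1 H2; eapply is_Cseries_eq with (3 := is_Cseries_plus _ _ _ _ H1 H2);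
  [intros m; ring | easy].
Qed.

Lemma egf_scal (u x : C) (f : nat -> C) (l : C) :
  egf u f l -> egf u (fun m => x * f m) (x * l).
Proof.
intros H; eapply is_Cseries_eq with (3 := is_Cseries_scal x _ _ H);
  [intros m; ring | easy].
Qed.

(** The identity [m / m! = 1 / (m - 1)!] turns the lowered index into a shift of the series. At
    [m = 0] the junk value [f 0] is multiplied by [INR 0]. *)
Lemma egf_raise (u : C) (f : nat -> C) (l : C) :
  egf u f l -> egf u (fun m => RtoC (INR m) * f (m - 1)%nat) (u * l).
Proof.
intros H; apply (is_series_decr_1 (K := C_AbsRing) (V := C_NormedModule)).
eapply is_Cseries_eq with (3 := is_Cseries_scal u _ _ H).
- intros m; cbv beta; replace (S m - 1)%nat with m by lia.
  rewrite RtoC_fact_S, Cpow_S; field.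
  split; [apply INR_fact_neq_0_C | apply INR_S_neq_0_C].
- change plus with Cplus; change opp with Copp; simpl INR; Cring.
Qed.

(* Induction on [n], with [herm_S_r] on the left factor: the lowered factor
   [m * herm (m - 1)] turns into a shift [m -> m + 1] of the right one, which
   [herm_S_l] expands again. The result satisfies the recursion defining [herm]. *)
Lemma egf_herm_mult (u c a b c' a' b' : C) (n p : nat) :
  egf u (fun m => herm c a b m n * herm c' a' b' m p)
    (Cexp (u * a * a') * herm (c * c' * u) (b + c * u * a') (b' + c' * u * a) n p).
Proof.
revert p; induction n as [|n IH]; intros p.
- induction p as [|p IH].
  + eapply egf_ext with (f := fun m => (a * a') ^ m) (l := Cexp (u * a * a')).
    * intros m; now rewrite !herm_0_r, Cpow_mult_l.
    * simpl; ring.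
    * eapply is_Cseries_eq with (3 := is_series_Cexp (u * a * a')); [intros m | easy].
      rewrite !Cpow_mult_l; unfold Cdiv; ring.
  (* With [n = 0] the left factor is [a ^ m], and the extra [a] makes up for its lowered
     exponent. *)
  + apply egf_ext with (3 := egf_plus _ _ _ _ _ (egf_scal _ b' _ _ IH)
      (egf_scal _ (c' * a) _ _ (egf_raise _ _ _ IH))).
    * intros m; rewrite herm_S_r, !herm_0_r.
      destruct m as [|m]; [simpl; ring|].
      replace (S m - 1)%nat with m by lia; rewrite Cpow_S; ring.
    * simpl; ring.
- apply egf_ext with (3 := egf_plus _ _ _ _ _ (egf_scal _ b _ _ (IH p))
    (egf_scal _ c _ _ (egf_raise _ _ _
      (egf_plus _ _ _ _ _ (egf_scal _ a' _ _ (IH p))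
        (egf_scal _ (RtoC (INR p) * c') _ _ (IH (p - 1)%nat)))))).
  + intros m; rewrite herm_S_r.
    destruct m as [|m]; [simpl; ring|].
    rewrite (herm_S_l c' a' b'); replace (S m - 1)%nat with m by lia; ring.
  + rewrite (herm_S_l (c * c' * u)); ring.
Qed.

(** At [a = 0] only the term [k = m] of the explicit sum for [herm] survives, and it needs [m <= n];
    [herm_1_0_le] evaluates that case. *)
Lemma herm_1_0_lt (b : C) (m n : nat) : (n < m)%nat -> herm 1 0 b m n = 0.
Proof.
revert n; induction m as [|m IH]; intros n H; [lia|]; rewrite herm_S_l.
destruct n as [|n]; [simpl; ring|].
rewrite (IH (S n - 1)%nat) by lia; ring.
Qed.

Lemma herm_1_0_le (b : C) (m p : nat) :
  herm 1 0 b m (m + p) = RtoC (INR (fact (m + p))) / RtoC (INR (fact p)) * b ^ p.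
Proof.
induction m as [|m IH].
- simpl; field; apply INR_fact_neq_0_C.
- rewrite herm_S_l; replace (S m + p - 1)%nat with (m + p)%nat by lia.
  rewrite IH; simpl (S m + p)%nat; rewrite RtoC_fact_S; field; apply INR_fact_neq_0_C.
Qed.

(* [egf_herm_mult] at [a = a' = 0], where [herm 1 0] is a monomial, expands
   [herm] explicitly. *)
Lemma herm_diagonal (v c a b : C) (n : nat) :
  sum_n (fun p => RtoC (binomR p (n - p)) * (v * c) ^ (n - p)
                  * ((v * a * b) ^ p / RtoC (INR (fact p)))) n
  = v ^ n / RtoC (INR (fact n)) * herm c a b n n.
Proof.
(* Taking [u] to be [c], with unit coefficients, makes the right side [herm c a b n n], while the
   series on the left stops at [m = n]. *)
assert (H := egf_herm_mult c 1 0 a 1 0 b n n); apply (is_series_finite _ _ n) in H.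
2:{ intros k Hk; rewrite herm_1_0_lt by easy; ring. }
replace (c * 0 * 0) with (RtoC 0) in H by ring.
replace (1 * 1 * c) with c in H by ring.
replace (a + 1 * c * 0) with a in H by ring.
replace (b + 1 * c * 0) with b in H by ring.
rewrite Cexp_0, Cmult_1_l in H; rewrite H.
rewrite <- (sum_n_mult_l (K := C_Ring) (v ^ n / RtoC (INR (fact n)))).
(* Reversal replaces the index [m] by [p = n - m], the exponent of [a] and [b]. *)
rewrite <- (sum_n_rev (fun m => mult (v ^ n / RtoC (INR (fact n)) : C_Ring) _)).
apply sum_n_ext_loc; intros p Hp; change mult with Cmult.
destruct (Nat.le_exists_sub p n Hp) as [j [-> _]].
replace (j + p - p)%nat with j by lia.
rewrite !herm_1_0_le.
unfold binomR; rewrite (Nat.add_comm p j), RtoC_div, RtoC_mult.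
2:{ apply Rmult_integral_contrapositive; split; apply INR_fact_neq_0. }
rewrite !Cpow_mult_l, Cpow_add_r.
match goal with |- @eq _ ?x ?y => change (@eq C x y) end.
field; repeat split; apply INR_fact_neq_0_C.
Qed.

Lemma egf_herm_diagonal (v c a b : C) :
  (Cmod (v * c) < 1)%R ->
  egf v (fun n => herm c a b n n) (/ (1 - v * c) * Cexp (v * a * b / (1 - v * c))).
Proof.
intros H; eapply is_Cseries_eq with (3 := is_series_laguerre _ (v * a * b) H);
  [intros n; apply herm_diagonal | easy].
Qed.

(** * The double sum for independent parameters *)

Definition mehler_term (u v c a b c' a' b' : C) (m n : nat) : C :=
  u ^ m * v ^ n / RtoC (INR (fact m)) / RtoC (INR (fact n))
  * (herm c a b m n * herm c' a' b' m n).

Lemma mehler_term_maj (u v c a b c' a' b' u0 v0 c0 a0 b0 c0' a0' b0' : C) (m n : nat) :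
  maj u u0 -> maj v v0 -> maj c c0 -> maj a a0 -> maj b b0 ->
  maj c' c0' -> maj a' a0' -> maj b' b0' ->
  maj (mehler_term u v c a b c' a' b' m n)
      (mehler_term u0 v0 c0 a0 b0 c0' a0' b0' m n).
Proof.
intros; unfold mehler_term; apply maj_mult.
- repeat (apply maj_div; [apply INR_fact_lt_0|]).
  apply maj_mult; now apply maj_pow.
- apply maj_mult; now apply herm_maj.
Qed.

(** The sum over [m] comes from [egf_herm_mult], the sum over [n] from [egf_herm_diagonal]. The
    inner sums stay existential, since only their existence matters for the majorization. *)
Lemma mehler_iterated (u v c a b c' a' b' : C) :
  (Cmod (v * (c * c' * u)) < 1)%R ->
  exists S : nat -> C,
    (forall n, is_series (fun m => mehler_term u v c a b c' a' b' m n) (S n)) /\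
    is_series S (Cexp (u * a * a') * (/ (1 - v * (c * c' * u)) *
      Cexp (v * (b + c * u * a') * (b' + c' * u * a) / (1 - v * (c * c' * u))))).
Proof.
intros H.
pose (Hn := fun n => herm (c * c' * u) (b + c * u * a') (b' + c' * u * a) n n).
exists (fun n => v ^ n / RtoC (INR (fact n)) * (Cexp (u * a * a') * Hn n)); split.
- intros n.
  eapply is_Cseries_eq with (3 := is_Cseries_scal (v ^ n / RtoC (INR (fact n))) _ _
    (egf_herm_mult u c a b c' a' b' n n)); [intros m | easy].
  unfold mehler_term, Cdiv; ring.
- apply egf_scal, egf_herm_diagonal, H.
Qed.

Lemma mehler_herm (u v c a b c' a' b' : C) :
  (Cmod (v * (c * c' * u)) < 1)%R ->
  is_double_series (mehler_term u v c a b c' a' b')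
    (Cexp (u * a * a') * (/ (1 - v * (c * c' * u)) *
      Cexp (v * (b + c * u * a') * (b' + c' * u * a) / (1 - v * (c * c' * u))))).
Proof.
intros H; destruct (mehler_iterated u v c a b c' a' b' H) as [S [I1 I2]].
pose (N := fun x => RtoC (Cmod x)).
destruct (mehler_iterated (N u) (N v) (N c) (N a) (N b) (N c') (N a') (N b'))
  as [S' [J1 J2]].
(* The condition involves only the modulus of a product, so it is the same for the moduli of the
   parameters. *)
{ unfold N; rewrite !Cmod_mult, !Cmod_RtoC_Cmod; now rewrite !Cmod_mult in H. }
refine (majorized_double_series _ _ _ _ _ _ _ I1 I2
  (fun n => is_series_Re _ _ (J1 n)) (is_series_Re _ _ J2)).
intros m n; apply mehler_term_maj; apply maj_Cmod.
Qed.

(** * Wirtinger derivatives and Mehler's formula *)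

(** At fixed [c], differentiating [herm] in [a] lowers [m] with a factor [m], and in [b] lowers [n]
    with a factor [n] (Appell property); the chain rule combines the two. *)
Lemma is_Cderive_herm (c : C) (f g : R -> C) (t : R) (k l : C) (m n : nat) :
  is_Cderive f t k -> is_Cderive g t l ->
  is_Cderive (fun s => herm c (f s) (g s) m n) t
    (RtoC (INR m) * herm c (f t) (g t) (m - 1) n * k
     + RtoC (INR n) * herm c (f t) (g t) m (n - 1) * l).
Proof.
intros Hf Hg; revert n; induction m as [|m IH]; intros n.
- destruct n as [|n].
  + apply is_Cderive_eq with (1 := is_Cderive_const 1 t); simpl; ring.
  + apply is_Cderive_eq with (1 := is_Cderive_pow g t l n Hg).
    replace (S n - 1)%nat with n by lia; simpl herm; simpl (INR 0); ring.
- eapply is_Cderive_eq.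
  { exact (is_Cderive_plus _ _ _ _ _ (is_Cderive_mult _ _ _ _ _ Hf (IH n))
      (is_Cderive_mult _ _ _ _ _ (is_Cderive_const (RtoC (INR n) * c) t)
         (IH (n - 1)%nat))). }
  replace (S m - 1)%nat with m by lia; rewrite herm_S_l, RtoC_INR_S.
  destruct m as [|m]; [simpl INR; simpl herm; ring|].
  rewrite (herm_S_l _ _ _ m n); replace (S m - 1)%nat with m by lia; ring.
Qed.

Lemma dx_eq (f : C -> C) (z l : C) :
  is_Cderive (fun t => f (t, Im z)) (Re z) l -> dx f z = l.
Proof.
intros [H1 H2]; unfold dx; apply injective_projections; simpl;
  now apply is_derive_unique.
Qed.

Lemma dy_eq (f : C -> C) (z l : C) :
  is_Cderive (fun t => f (Re z, t)) (Im z) l -> dy f z = l.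
Proof.
intros [H1 H2]; unfold dy; apply injective_projections; simpl;
  now apply is_derive_unique.
Qed.

Lemma dx_ext (f g : C -> C) (z : C) : (forall x, f x = g x) -> dx f z = dx g z.
Proof. intros E; unfold dx; f_equal; apply Derive_ext; intros t; now rewrite E. Qed.

Lemma dy_ext (f g : C -> C) (z : C) : (forall x, f x = g x) -> dy f z = dy g z.
Proof. intros E; unfold dy; f_equal; apply Derive_ext; intros t; now rewrite E. Qed.

Lemma wirtinger_ext (f g : C -> C) (z : C) :
  (forall x, f x = g x) -> wirtinger f z = wirtinger g z.
Proof. intros E; unfold wirtinger; now rewrite (dx_ext f g), (dy_ext f g). Qed.

Lemma wirtinger_bar_ext (f g : C -> C) (z : C) :
  (forall x, f x = g x) -> wirtinger_bar f z = wirtinger_bar g z.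
Proof. intros E; unfold wirtinger_bar; now rewrite (dx_ext f g), (dy_ext f g). Qed.

(** The closed form of the iterated Wirtinger derivatives of the Gaussian, as [iter_wirtinger]
    shows. *)
Definition herm_gauss (nu : R) (m n : nat) (x : C) : C :=
  herm (- RtoC nu) (- RtoC nu * x) (- RtoC nu * Cconj x) m n
  * Cexp (- (RtoC nu * (x * Cconj x))).

(** The curve and its conjugate keep separate velocities [k] and [l], so that their coefficients are
    the two Wirtinger derivatives. *)
Lemma is_Cderive_herm_gauss (nu : R) (m n : nat) (z zb : R -> C) (t : R) (k l : C) :
  (forall s, zb s = Cconj (z s)) -> is_Cderive z t k -> is_Cderive zb t l ->
  is_Cderive (fun s => herm_gauss nu m n (z s)) t
    (((RtoC (INR m) * herm (- RtoC nu) (- RtoC nu * z t) (- RtoC nu * zb t) (m - 1) n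
       + zb t * herm (- RtoC nu) (- RtoC nu * z t) (- RtoC nu * zb t) m n) * k
      + (RtoC (INR n) * herm (- RtoC nu) (- RtoC nu * z t) (- RtoC nu * zb t) m (n - 1)
         + z t * herm (- RtoC nu) (- RtoC nu * z t) (- RtoC nu * zb t) m n) * l)
     * (- RtoC nu * Cexp (- (RtoC nu * (z t * zb t))))).
Proof.
intros E Hk Hl.
apply is_Cderive_ext with (fun s =>
  herm (- RtoC nu) (- RtoC nu * z s) (- RtoC nu * zb s) m n
  * Cexp (- RtoC nu * (z s * zb s))).
{ intros s; unfold herm_gauss; rewrite E; f_equal; f_equal; ring. }
assert (S : forall f k, is_Cderive f t k ->
  is_Cderive (fun s => - RtoC nu * f s) t (- RtoC nu * k)).
{ intros f j H; eapply is_Cderive_eq.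
  - exact (is_Cderive_mult _ _ _ _ _ (is_Cderive_const (- RtoC nu) t) H).
  - cbv beta; ring. }
eapply is_Cderive_eq.
- apply (is_Cderive_mult _ _ _ _ _ (is_Cderive_herm _ _ _ _ _ _ m n (S _ _ Hk) (S _ _ Hl))
    (is_Cderive_Cexp _ _ _ (S _ _ (is_Cderive_mult _ _ _ _ _ Hk Hl)))).
- replace (- RtoC nu * (z t * zb t)) with (- (RtoC nu * (z t * zb t))) by ring.
  ring.
Qed.

Lemma wirtinger_herm_gauss (nu : R) (m n : nat) (x : C) :
  wirtinger (herm_gauss nu m n) x =
    (RtoC (INR m) * herm (- RtoC nu) (- RtoC nu * x) (- RtoC nu * Cconj x) (m - 1) n
     + Cconj x * herm (- RtoC nu) (- RtoC nu * x) (- RtoC nu * Cconj x) m n)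
    * (- RtoC nu * Cexp (- (RtoC nu * (x * Cconj x)))) /\
  wirtinger_bar (herm_gauss nu m n) x =
    (RtoC (INR n) * herm (- RtoC nu) (- RtoC nu * x) (- RtoC nu * Cconj x) m (n - 1)
     + x * herm (- RtoC nu) (- RtoC nu * x) (- RtoC nu * Cconj x) m n)
    * (- RtoC nu * Cexp (- (RtoC nu * (x * Cconj x)))).
Proof.
assert (Ci2 : Ci * Ci = - (1)) by (apply injective_projections; simpl; ring).
assert (Ex : (Re x, Im x) = x) by now destruct x.
assert (Exb : (Re x, (- Im x)%R) = Cconj x) by now destruct x.
assert (Aff : forall (f : R -> C) (p q : C) t,
  (forall s, p + RtoC s * q = f s) -> is_Cderive f t q).
{ intros f p q t E; apply is_Cderive_ext with (1 := E); eapply is_Cderive_eq.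
  - exact (is_Cderive_plus _ _ _ _ _ (is_Cderive_const p t)
      (is_Cderive_mult _ _ _ _ _ (is_Cderive_RtoC t) (is_Cderive_const q t))).
  - cbv beta; ring. }
(* Along the real direction the point and its conjugate both have velocity 1; along the imaginary
   one, [Ci] and [- Ci]. The derivative itself is left to unification. *)
eassert (Dx : is_Cderive (fun t => herm_gauss nu m n (t, Im x)) (Re x) _).
{ apply (is_Cderive_herm_gauss nu m n (fun t => (t, Im x)) (fun t => (t, - Im x)%R)
           (Re x) 1 1).
  - easy.
  - apply Aff with (0, Im x)%R; intros s; apply injective_projections; simpl; ring.
  - apply Aff with (0, - Im x)%R; intros s; apply injective_projections; simpl; ring. }
eassert (Dy : is_Cderive (fun t => herm_gauss nu m n (Re x, t)) (Im x) _).
{ apply (is_Cderive_herm_gauss nu m n (fun t => (Re x, t)) (fun t => (Re x, - t)%R)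
           (Im x) Ci (- Ci)).
  - easy.
  - apply Aff with (Re x, 0)%R; intros s; apply injective_projections; simpl; ring.
  - apply Aff with (Re x, 0)%R; intros s; apply injective_projections; simpl; ring. }
apply dx_eq in Dx; apply dy_eq in Dy; cbv beta in Dx, Dy; rewrite Ex, Exb in Dx, Dy.
unfold wirtinger, wirtinger_bar; rewrite Dx, Dy.
(* With [P] and [Q] the coefficients of the two velocities, the Wirtinger combinations isolate [P]
   and [Q] respectively. *)
assert (A : forall P Q E, / 2 * ((P * 1 + Q * 1) * E - Ci * ((P * Ci + Q * - Ci) * E)) = P * E
  /\ / 2 * ((P * 1 + Q * 1) * E + Ci * ((P * Ci + Q * - Ci) * E)) = Q * E).
{ intros P Q E; split.
  - transitivity (/ 2 * ((P + Q) * E - Ci * Ci * (P - Q) * E)); [ring|].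
    rewrite Ci2; field.
  - transitivity (/ 2 * ((P + Q) * E + Ci * Ci * (P - Q) * E)); [ring|].
    rewrite Ci2; field. }
split; apply A.
Qed.

(** The [wirtinger] steps act first, at [m = 0], where each just multiplies by [b]; each
    [wirtinger_bar] step is then the defining recursion of [herm]. *)
Lemma iter_wirtinger (nu : R) (m n : nat) (x : C) :
  Nat.iter m wirtinger_bar
    (Nat.iter n wirtinger (fun x : C => Cexp (- (nu * (x * Cconj x))))) x
  = herm_gauss nu m n x.
Proof.
revert x; induction m as [|m IH]; intros x.
- simpl; revert x; induction n as [|n IH]; intros x.
  + unfold herm_gauss; simpl; ring.
  + simpl; rewrite (wirtinger_ext _ _ _ IH).
    rewrite (proj1 (wirtinger_herm_gauss nu 0 n x)).
    unfold herm_gauss; simpl; ring.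
- simpl; rewrite (wirtinger_bar_ext _ _ _ IH).
  rewrite (proj2 (wirtinger_herm_gauss nu m n x)).
  unfold herm_gauss; rewrite herm_S_l; ring.
Qed.

Lemma hermite_herm (nu : R) (m n : nat) (z : C) :
  hermite nu m n z =
  (- (1)) ^ (m + n) * herm (- RtoC nu) (- RtoC nu * z) (- RtoC nu * Cconj z) m n.
Proof.
unfold hermite; rewrite iter_wirtinger; unfold herm_gauss.
set (H := herm _ _ _ _ _).
transitivity ((- (1)) ^ (m + n) * H
  * (Cexp (nu * (z * Cconj z)) * Cexp (- (nu * (z * Cconj z))))); [ring|].
rewrite <- Cexp_plus.
replace (nu * (z * Cconj z) + - (nu * (z * Cconj z))) with (RtoC 0) by ring.
rewrite Cexp_0; ring.
Qed.

Lemma is_double_series_ext (a b : nat -> nat -> C) (l : C) :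
  (forall m n, a m n = b m n) -> is_double_series a l -> is_double_series b l.
Proof.
intros E [[B HB] H]; split.
- exists B; intros M N.
  rewrite (sum_n_ext _ (fun m => sum_n (fun n => Cmod (a m n)) N)); [apply HB|].
  intros m; apply sum_n_ext; intros n; now rewrite E.
- eapply filterlim_ext with (2 := H).
  intros p; apply sum_n_ext; intros m; apply sum_n_ext; intros n; apply E.
Qed.

Theorem theorem4p1 (nu nu' : R) (u v : C)
    (huv_real : Im (u * v) = 0%R)
    (huv_lt1 : (nu * nu' * Re (u * v) < 1)%R)
    (huv_gtN1 : (-1 < nu * nu' * Re (u * v))%R)
    (z w : C) :
  is_double_series
    (fun m n : nat =>
       u ^ m * v ^ n / (INR (fact m) * INR (fact n)) *
       hermite nu m n z * hermite nu' m n w)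
    (1 / (1 - nu * nu' * (u * v)) *
     Cexp (- (nu * nu' *
              ((nu * (Cmod z ^ 2)%R + nu' * (Cmod w ^ 2)%R) * (u * v)
               - u * z * w - v * Cconj z * Cconj w)
              / (1 - nu * nu' * (u * v))))).
Proof.
(* As [u * v] is real, the two bounds on [nu * nu' * Re (u * v)] say that the modulus is less than
   1, as the majorant requires. *)
assert (Hq : (Cmod (nu * nu' * (u * v)) < 1)%R).
{ assert (E : u * v = RtoC (Re (u * v))) by (now apply injective_projections).
  rewrite E, <- !RtoC_mult, Cmod_R; now apply Rabs_def1. }
assert (Hq1 := one_minus_neq_0 _ Hq).
assert (Eq : v * (- RtoC nu * - RtoC nu' * u) = nu * nu' * (u * v)) by ring.
assert (M := mehler_herm u v (- RtoC nu) (- RtoC nu * z) (- RtoC nu * Cconj z)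
  (- RtoC nu') (- RtoC nu' * w) (- RtoC nu' * Cconj w)).
rewrite Eq in M; specialize (M Hq).
eapply is_double_series_ext.
(* Identifying the sum first fixes the terms to be compared in the remaining goal. *)
2:{ match type of M with is_double_series _ ?l => match goal with
      |- is_double_series _ ?k => replace k with l; [exact M|] end end.
  transitivity (/ (1 - nu * nu' * (u * v)) * (
    Cexp (u * (- RtoC nu * z) * (- RtoC nu' * w)) *
    Cexp (v * (- RtoC nu * Cconj z + - RtoC nu * u * (- RtoC nu' * w))
     * (- RtoC nu' * Cconj w + - RtoC nu' * u * (- RtoC nu * z))
     / (1 - nu * nu' * (u * v))))); [ring|].
  (* Once the squared moduli are written as [z * Cconj z] and [w * Cconj w], the exponents agree as
     rational functions with the conjugates as independent variables. *)
  rewrite <- Cexp_plus, !Cmod2_conj; unfold Cdiv at 2; rewrite Cmult_1_l.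
  f_equal; f_equal; field; exact Hq1. }
intros m n; unfold mehler_term; cbv beta; rewrite !hermite_herm.
assert (Sgn : (- (1)) ^ (m + n) * (- (1)) ^ (m + n) = 1).
{ rewrite <- Cpow_mult_l; replace (- (1) * - (1)) with (RtoC 1) by ring.
  apply Cpow_1_l. }
set (H := herm _ _ _ _ _); set (H' := herm _ _ _ _ _).
transitivity (u ^ m * v ^ n / (INR (fact m) * INR (fact n)) *
  ((- (1)) ^ (m + n) * (- (1)) ^ (m + n)) * (H * H')); [|ring].
rewrite Sgn; field; split; apply INR_fact_neq_0_C.
Qed.
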